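(* Adopt the setting of the context (in particular $f\ge0$). Let $\pi:\mathbb R^d\to A$ be a Borel feedback and $x_0\in\mathbb R^d$ with $S_{\varepsilon,h}(\pi)(x_0)\le C_0$. Then, for every $\delta\in(0,M_p]$, $$\frac1\mu\,\mathbb E_{x_0}^\pi\Bigl[\sum_{m=0}^\infty\gamma_h^m\,\mathbf 1_{\{\mathrm{dist}(Y_m,\overline\Omega)\ge\delta\}}\Bigr]\le\frac{C_0\,\varepsilon}{\delta}.$$
   Context: Setting. $|\cdot|$ is the Euclidean norm. $\Omega\subset\mathbb R^d$ is a bounded domain with $C^2$ boundary and outward unit normal $n$; $A\subset\mathbb R^m$ is compact; $\lambda>0$; $b:\mathbb R^d\times A\to\mathbb R^d$ and $f:\mathbb R^d\times A\to[0,\infty)$ are continuous, bounded, and Lipschitz in $x$ uniformly in $a$, with $\mathrm{Lip}_x(b)<\lambda$. There is $\nu>0$ such that for each $x\in\partial\Omega$ some $a\in A$ satisfies $b(x,a)\cdot n(x)\le-\nu$. The Hamiltonian $H(x,p)=\sup_{a\in A}\{-b(x,a)\cdot p-f(x,a)\}$ tends to $\infty$ as $|p|\to\infty$ uniformly in $x\in\overline\Omega$. For a fixed $M_p>0$, $p_\Omega(x)=\min\{\mathrm{dist}(x,\overline\Omega),M_p\}$. $N>0$ is fixed with $N\ge\frac12\sup_{x,a}\max_i|b_i(x,a)|$; $h,\varepsilon>0$. Scheme. $(\nabla_hv)_i(x)=\frac{v(x+he_i)-v(x-he_i)}{2h}$, $\Delta_hv(x)=\sum_{i=1}^d\frac{v(x+he_i)-2v(x)+v(x-he_i)}{h^2}$,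 $\nu_h=Nh$; $c_\pi=f(\cdot,\pi)+p_\Omega/\varepsilon$. $S_{\varepsilon,h}(\pi)$ is the unique bounded Borel function $v$ on $\mathbb R^d$ with $\lambda v-b(\cdot,\pi)\cdot\nabla_hv-\nu_h\Delta_hv=c_\pi$ pointwise. Jump chain. $\Lambda_h=2dN/h$, $\mu=\lambda+\Lambda_h$, $\gamma_h=\Lambda_h/\mu$. Given $\pi$ and $x$, $(Y_m)_{m\ge0}$ is the Markov chain on $x+h\mathbb Z^d$ with $Y_0=x$ jumping from $y$ to $y\pm he_i$ with probability $\frac{N\pm b_i(y,\pi(y))/2}{2dN}$; $\mathbb E_x^\pi$ is its expectation. One has $S_{\varepsilon,h}(\pi)(x)=\mu^{-1}\mathbb E_x^\pi\sum_{m\ge0}\gamma_h^mc_\pi(Y_m)$. *)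

(* Defs.v *)
From HB Require Import structures.
From mathcomp Require Import all_boot all_order all_algebra.
From mathcomp Require Import all_classical all_reals all_analysis.

Set Implicit Arguments.
Unset Strict Implicit.
Unset Printing Implicit Defensive.

Import Order.TTheory GRing.Theory Num.Theory.
Import numFieldNormedType.Exports.

Local Open Scope classical_set_scope.
Local Open Scope ring_scope.

(** R^d is ['rV[R]_d]. The library norm on it is the sup norm, which induces the
    usual topology; the Euclidean norm is [enorm]. *)
Section Euclidean.
Context {R : realType} {d : nat}.
Implicit Types (x y u v : 'rV[R]_d) (D : set 'rV[R]_d).

Definition dot u v : R := \sum_(i < d) u 0 i * v 0 i.

Definition enorm u : R := Num.sqrt (\sum_(i < d) u 0 i ^+ 2).

Definition dist x D : R := inf [set enorm (x - z) | z in D].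

Definition basis_vec (i : 'I_d) : 'rV[R]_d := delta_mx 0 i.

Definition max_coord u : R := \big[Num.max/0]_(i < d) `|u 0 i|.

Definition bdry D : set 'rV[R]_d := closure D `\` interior D.

Definition gradient (g : 'rV[R]_d -> R) x : 'rV[R]_d :=
  \row_i 'D_(basis_vec i) g x.

Definition C2_on (U : set 'rV[R]_d) (g : 'rV[R]_d -> R) : Prop :=
  forall x, U x ->
    {for x, continuous g} /\
    forall i,
      [/\ derivable g x (basis_vec i),
          {for x, continuous ('D_(basis_vec i) g)} &
          forall j,
            derivable ('D_(basis_vec i) g) x (basis_vec j) /\
            {for x, continuous ('D_(basis_vec j) ('D_(basis_vec i) g))}].

Definition C2_defining_at (Omega : set 'rV[R]_d) (z : 'rV[R]_d)
    (rho : 'rV[R]_d -> R) : Prop :=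
  exists U : set 'rV[R]_d,
    [/\ open U, U z, C2_on U rho, (forall x, U x -> gradient rho x != 0) &
        Omega `&` U = [set x | rho x < 0] `&` U].

Definition C2_boundary (Omega : set 'rV[R]_d) : Prop :=
  forall z, bdry Omega z -> exists rho, C2_defining_at Omega z rho.

(** The normal points outward because [rho] is negative inside [Omega]; it does
    not depend on the choice of [rho]. *)
Definition outward_unit_normal (Omega : set 'rV[R]_d) z (nz : 'rV[R]_d) : Prop :=
  exists2 rho, C2_defining_at Omega z rho &
    nz = (enorm (gradient rho z))^-1 *: gradient rho z.

Definition borel_space := g_sigma_algebraType (@open 'rV[R]_d).

Definition borel_fun (v : 'rV[R]_d -> R) : Prop :=
  measurable_fun [set: borel_space] (v : borel_space -> R).

End Euclidean.
Arguments borel_space : clear implicits.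

Definition borel_map {R : realType} {d k : nat}
    (g : 'rV[R]_d -> 'rV[R]_k) : Prop :=
  measurable_fun [set: borel_space R d] (g : borel_space R d -> borel_space R k).

Section ControlData.
Context {R : realType} {d k : nat}.
Variables (A : set 'rV[R]_k) (b : 'rV[R]_d -> 'rV[R]_k -> 'rV[R]_d)
  (f : 'rV[R]_d -> 'rV[R]_k -> R).

(** Best Lipschitz constant of [b] in [x], uniformly over [A]; the pairs with
    [x = y] contribute the quotient [0 / 0 = 0]. *)
Definition Lip_x : \bar R :=
  ereal_sup [set r | exists x y a, A a /\
                     r = (enorm (b x a - b y a) / enorm (x - y))%:E].

Definition sup_coord : R :=
  sup [set r | exists x a, A a /\ r = max_coord (b x a)].

Definition hamiltonian (x p : 'rV[R]_d) : R :=
  sup [set - dot (b x a) p - f x a | a in A].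

Definition uniformly_coercive_on (D : set 'rV[R]_d) : Prop :=
  forall K : R, exists r : R, forall x p, D x -> r <= enorm p ->
    K <= hamiltonian x p.

End ControlData.

Section Rates.
Context {R : realType}.
Variables (d : nat) (lambda N h : R).

Definition jump_rate : R := 2 * d%:R * N / h.
Definition total_rate : R := lambda + jump_rate.
Definition discount : R := jump_rate / total_rate.

End Rates.

Section Scheme.
Context {R : realType} {d k : nat}.
Variables (Omega : set 'rV[R]_d) (b : 'rV[R]_d -> 'rV[R]_k -> 'rV[R]_d)
  (f : 'rV[R]_d -> 'rV[R]_k -> R) (lambda Mp N h eps : R).
Implicit Types (v : 'rV[R]_d -> R) (x y z : 'rV[R]_d)
  (pi : 'rV[R]_d -> 'rV[R]_k).

Definition penalty x : R := Num.min (dist x (closure Omega)) Mp.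

Definition grad_h v x : 'rV[R]_d :=
  \row_i ((v (x + h *: basis_vec i) - v (x - h *: basis_vec i)) / (2 * h)).

Definition laplace_h v x : R :=
  \sum_(i < d) (v (x + h *: basis_vec i) - 2 * v x + v (x - h *: basis_vec i))
               / h ^+ 2.

Definition running_cost pi x : R := f x (pi x) + penalty x / eps.

(** [v] is the bounded Borel solution S_{eps,h}(pi) of the linear scheme. *)
Definition is_scheme_value pi v : Prop :=
  [/\ borel_fun v,
      (exists M : R, forall x, `|v x| <= M) &
      forall x, lambda * v x - dot (b x (pi x)) (grad_h v x)
                - (N * h) * laplace_h v x = running_cost pi x].

Definition jump_prob pi y z : R :=
  \sum_(i < d)
    ((N + b y (pi y) 0 i / 2) / (2 * d%:R * N)
       * (z == y + h *: basis_vec i)%:R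
     + (N - b y (pi y) 0 i / 2) / (2 * d%:R * N)
       * (z == y - h *: basis_vec i)%:R).

Definition lattice x : set 'rV[R]_d :=
  [set y | exists z : 'rV[int]_d, y = x + h *: map_mx intr z].

(** The state space is countable, so the process is measurable as soon as its
    level sets are; the last clause is the Markov property together with the
    transition law, in a form that avoids conditioning on null events. *)
Definition is_jump_chain pi x (disp : measure_display)
    (T : measurableType disp) (P : probability T R)
    (Y : nat -> T -> 'rV[R]_d) : Prop :=
  [/\ forall m t, lattice x (Y m t),
      forall m y, measurable [set t | Y m t = y],
      P [set t | Y 0%N t = x] = 1%E &
      forall m (y : nat -> 'rV[R]_d) z,
        P [set t | (forall j, (j <= m)%N -> Y j t = y j) /\ Y m.+1 t = z]
        = (P [set t | forall j, (j <= m)%N -> Y j t = y j]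
           * (jump_prob pi (y m) z)%:E)%E].

End Scheme.

(* Main.v *)
(** The scheme says that [S_pi = gamma * (one-step mean of S_pi) + c / mu], with
    jump weights that are nonnegative because [|b_i| / 2 <= N]; hence
    [S_pi >= 0], and since [c >= delta / eps] where [dist >= delta], the function
    [w = (mu * eps / delta) * S_pi] satisfies
    [1_{dist >= delta} + gamma * (one-step mean of w) <= w]. By induction on [n],
    conditionally on any initial path of the chain ending at [y], the expected
    discounted sum of the next [n] indicators is at most [w y]; let [n] tend to
    infinity by monotone convergence. *)
Require Import Defs.
From HB Require Import structures.
From mathcomp Require Import all_boot all_order all_algebra.
From mathcomp Require Import all_classical all_reals all_analysis.
From mathcomp Require Import measurable_realfun.
From mathcomp Require Import ring lra.
Set Implicit Arguments.
Unset Strict Implicit.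
Unset Printing Implicit Defensive.
Import Order.TTheory GRing.Theory Num.Theory.
Import numFieldNormedType.Exports.
Local Open Scope classical_set_scope.
Local Open Scope ring_scope.

(** * Integration over a finite partition up to a null set *)

Section AlmostPartition.
Context d (T : measurableType d) (R : realType) (P : probability T R).
Context (I : choiceType) (E : set T) (F : I -> set T) (s : seq I).
Local Open Scope ereal_scope.

(** The pieces need not cover [E]: since [P] is finite and the masses add up, the uncovered part of
    [E] is null and contributes nothing. This suits the chain, whose law gives the masses of the
    possible next states but no sure inclusion. *)
Lemma ge0_integral_ae_partition (f : T -> \bar R) :
  measurable E -> (forall i, measurable (F i)) -> uniq s ->
  trivIset [set` s] F -> (forall i, F i `<=` E) ->
  P E = \sum_(i <- s) P (F i) ->
  measurable_fun E f -> (forall t, E t -> 0 <= f t) ->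
  \int[P]_(t in E) f t = \sum_(i <- s) \int[P]_(t in F i) f t.
Proof.
move=> mE mF us tF FE PE mf f0.
pose U := \big[setU/set0]_(i <- s) F i.
have mU : measurable U by apply: bigsetU_measurable.
have UE : U `<=` E.
  by rewrite /U -bigcup_seq; apply: bigcup_sub => i _; exact: FE.
have PU : P U = P E.
  rewrite PE -[P U]mul1e -integral_cst//.
  rewrite (ge0_integral_bigsetU P mF us tF)//.
  by apply: eq_bigr => i _; rewrite integral_cst// mul1e.
have P0 : P (E `\` U) = 0.
  rewrite measureD//; last by rewrite ltey_eq fin_num_measure.
  by rewrite setIidr//; rewrite [X in _ - X]PU subee// fin_num_measure.
have mD : measurable (E `\` U) by exact: measurableD.
have EU : E = U `|` (E `\` U) by rewrite setDUK.
rewrite {1}EU ge0_integral_setU//.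
- rewrite (null_set_integral mD _ P0) ?adde0; last first.
    by apply: measurable_funS mf => // t [].
  rewrite (ge0_integral_bigsetU P mF us tF)// => [|t Ut].
    by apply: measurable_funS mf.
  by apply/f0/UE.
- by rewrite -EU.
- by rewrite -EU.
- by apply/disj_setPS => t [Ut []].
Qed.

End AlmostPartition.

(** * The one-step transition operator *)

Section JumpKernel.
Context (R : realType) (d k : nat).
Context (b : 'rV[R]_d -> 'rV[R]_k -> 'rV[R]_d) (N h : R).
Context (pi : 'rV[R]_d -> 'rV[R]_k).
Implicit Types (v : 'rV[R]_d -> R) (y z : 'rV[R]_d).

(** The conditional mean of [v] at the next state, given the current state [y]; it is summed over
    directions to match the stencil of the scheme. *)
Definition jump_mean v y : R :=
  \sum_(i < d)
    ((N + b y (pi y) 0 i / 2) / (2 * d%:R * N) * v (y + h *: basis_vec i)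
   + (N - b y (pi y) 0 i / 2) / (2 * d%:R * N) * v (y - h *: basis_vec i)).

(** Duplicates are removed because [h] is unrestricted here, and all targets coincide when [h = 0];
    [jump_prob] already adds the weights of coinciding targets. *)
Definition neighbours y : seq 'rV[R]_d :=
  undup ([seq y + h *: basis_vec i | i <- enum 'I_d] ++
         [seq y - h *: basis_vec i | i <- enum 'I_d]).

Lemma sum_delta_seq (I : eqType) (s : seq I) (a : I) (F : I -> R) :
  uniq s -> a \in s -> \sum_(z <- s) (z == a)%:R * F z = F a.
Proof.
move=> us sa; rewrite (bigD1_seq a)//= eqxx mul1r big1 ?addr0// => z /negPf ->.
by rewrite mul0r.
Qed.

Lemma sum_jump_prob v y :
  \sum_(z <- neighbours y) jump_prob b N h pi y z * v z = jump_mean v y.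
Proof.
have up i : y + h *: basis_vec i \in neighbours y.
  rewrite mem_undup mem_cat; apply/orP; left.
  by apply: (map_f (fun i => y + h *: basis_vec i)); rewrite mem_enum.
have dn i : y - h *: basis_vec i \in neighbours y.
  rewrite mem_undup mem_cat; apply/orP; right.
  by apply: (map_f (fun i => y - h *: basis_vec i)); rewrite mem_enum.
under eq_bigr do rewrite mulr_suml.
rewrite exchange_big /=; apply: eq_bigr => i _.
under eq_bigr do rewrite mulrDl -2!(mulrA (_ / _)).
by rewrite big_split /= -!mulr_sumr !sum_delta_seq// undup_uniq.
Qed.

(** The drift terms cancel between the two opposite jumps, so each coordinate carries total weight
    [d%:R^-1]. *)
Lemma jump_mean1 y : (0 < d)%N -> N != 0 -> jump_mean (fun=> 1) y = 1.
Proof.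
move=> d0 N0; rewrite /jump_mean.
have d0' : d%:R != 0 :> R by rewrite pnatr_eq0 -lt0n.
under eq_bigr => i _.
  rewrite !mulr1 (_ : _ + _ = d%:R^-1); last by field; rewrite N0 d0'.
  over.
by rewrite sumr_const card_ord -[LHS]mulr_natr mulVf.
Qed.

Hypothesis weight_ge0 : forall y i, `|b y (pi y) 0 i| / 2 <= N.

Lemma weight_up_ge0 y i : 0 <= (N + b y (pi y) 0 i / 2) / (2 * d%:R * N).
Proof.
have N0 : 0 <= N by apply: le_trans (weight_ge0 y i); rewrite divr_ge0.
apply: divr_ge0; last by rewrite !mulr_ge0.
have := weight_ge0 y i; have := ler_norm (- b y (pi y) 0 i); rewrite normrN; lra.
Qed.

Lemma weight_down_ge0 y i : 0 <= (N - b y (pi y) 0 i / 2) / (2 * d%:R * N).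
Proof.
have N0 : 0 <= N by apply: le_trans (weight_ge0 y i); rewrite divr_ge0.
apply: divr_ge0; last by rewrite !mulr_ge0.
have := weight_ge0 y i; have := ler_norm (b y (pi y) 0 i); lra.
Qed.

Lemma le_jump_mean v w y : (forall z, v z <= w z) -> jump_mean v y <= jump_mean w y.
Proof.
move=> vw; apply: ler_sum => i _.
by apply: lerD; apply: ler_wpM2l => //; [exact: weight_up_ge0|exact: weight_down_ge0].
Qed.

Lemma jump_meanZ (c : R) v y : jump_mean (fun z => c * v z) y = c * jump_mean v y.
Proof.
by rewrite mulr_sumr; apply: eq_bigr => i _; rewrite mulrDr 2!(mulrCA _ c).
Qed.

End JumpKernel.

(** * Supersolutions bound discounted sums along the chain *)

Section JumpChain.
Context (R : realType) (d k : nat).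
Context (b : 'rV[R]_d -> 'rV[R]_k -> 'rV[R]_d) (N h : R).
Context (pi : 'rV[R]_d -> 'rV[R]_k) (x0 : 'rV[R]_d).
Context (disp : measure_display) (T : measurableType disp) (P : probability T R).
Context (Y : nat -> T -> 'rV[R]_d).
Hypothesis Y_chain : is_jump_chain b N h pi x0 P Y.

(** [B] is arbitrary because the chain lives on a countable lattice. *)
Lemma measurable_chain_preimage m (B : set 'rV[R]_d) : measurable (Y m @^-1` B).
Proof.
have [Ylat mY _ _] := Y_chain.
pose pt (z : 'rV[int]_d) := x0 + h *: map_mx intr z.
have -> : Y m @^-1` B =
    \bigcup_z (if pt z \in B then [set t | Y m t = pt z] else set0).
  apply/seteqP; split=> [t Bt|t [z _]].
    have [z Yz] := Ylat m t; exists z => //.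
    by rewrite /pt -Yz mem_set.
  by case: ifPn => // /set_mem Bz /= ->.
apply: countable_bigcupT_measurable => [|z]; first exact: countableP.
by case: ifP.
Qed.

Lemma measurable_fun_chain m d' (U : sigmaRingType d') (g : 'rV[R]_d -> U)
  (D : set T) : measurable_fun D (g \o Y m).
Proof.
move=> mD B mB; apply: measurableI => //.
by rewrite comp_preimage; exact: measurable_chain_preimage.
Qed.

Definition path_event m (y : nat -> 'rV[R]_d) : set T :=
  [set t | forall j, (j <= m)%N -> Y j t = y j].

Lemma measurable_path_event m y : measurable (path_event m y).
Proof.
have -> : path_event m y = \bigcap_(j in [set j | (j <= m)%N]) [set t | Y j t = y j].
  by apply/seteqP; split.
apply: bigcap_measurable => [|j _]; first by exists 0%N.
exact: (measurable_chain_preimage j [set y j]).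
Qed.

(** Of the constant tail, [path_event m.+1] sees only the value at time [m.+1]. *)
Definition extend_path m (y : nat -> 'rV[R]_d) z (j : nat) : 'rV[R]_d :=
  if (j <= m)%N then y j else z.

Lemma path_eventS m y z :
  path_event m.+1 (extend_path m y z) = path_event m y `&` [set t | Y m.+1 t = z].
Proof.
apply/seteqP; split=> t.
  move=> Yt; split=> [j jm|/=]; last by rewrite Yt// /extend_path ltnn.
  by rewrite Yt ?leqW// /extend_path jm.
move=> [Yt Yz] j; rewrite leq_eqVlt ltnS /extend_path => /predU1P[->|jm].
  by rewrite ltnn.
by rewrite jm Yt.
Qed.

Lemma prob_path_eventS m y z :
  P (path_event m.+1 (extend_path m y z)) =
  (P (path_event m y) * (jump_prob b N h pi (y m) z)%:E)%E.
Proof. by have [_ _ _ <-] := Y_chain; rewrite path_eventS. Qed.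

Hypothesis (d_gt0 : (0 < d)%N) (N_gt0 : 0 < N).
Hypothesis weight_ge0 : forall y i, `|b y (pi y) 0 i| / 2 <= N.
Context (gamma : R) (g w : 'rV[R]_d -> R).
Hypothesis (gamma_ge0 : 0 <= gamma) (g_ge0 : forall y, 0 <= g y).
Hypothesis w_ge0 : forall y, 0 <= w y.
Hypothesis w_super : forall y, g y + gamma * jump_mean b N h pi w y <= w y.

Lemma measurable_discounted_sum (m n : nat) (D : set T) :
  measurable_fun D (fun t => (\sum_(j < n) gamma ^+ j * g (Y (m + j) t))%:E).
Proof.
apply/measurable_EFinP; apply: measurable_sum => j.
exact: (@measurable_fun_chain _ _ _ (fun y => gamma ^+ j * g y)).
Qed.

Lemma discounted_sum_ge0 m n t : 0 <= \sum_(j < n) gamma ^+ j * g (Y (m + j) t).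
Proof. by apply: sumr_ge0 => j _; rewrite mulr_ge0// exprn_ge0. Qed.

(** Multiplying by the probability of the path replaces conditioning, so null paths need no separate
    treatment. The induction on [n] keeps [m] and [y] general, since its hypothesis is applied to
    paths longer by one step. *)
Lemma path_discounted_sum_le n m y :
  (\int[P]_(t in path_event m y)
     (\sum_(j < n) gamma ^+ j * g (Y (m + j) t))%:E
   <= P (path_event m y) * (w (y m))%:E)%E.
Proof.
elim: n m y => [|n IH] m y.
  under eq_integral do rewrite big_ord0.
  by rewrite integral0 mule_ge0// lee_fin.
set E := path_event m y.
pose F z := path_event m.+1 (extend_path m y z).
have mF z : measurable (F z) by exact: measurable_path_event.
have [p PE] : exists p, P E = p%:E.
  exists (fine (P E)); rewrite fineK// fin_num_measure//.
  exact: measurable_path_event.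
have p_ge0 : 0 <= p by rewrite -lee_fin -PE.
(* Total mass one serves twice: it shows that the events [F z] exhaust [E] up to a null set, and it
   spreads [g (y m)] over the neighbours. *)
have sum1 : \sum_(z <- neighbours h (y m)) jump_prob b N h pi (y m) z = 1.
  rewrite -(jump_mean1 b h pi (y m) d_gt0 (lt0r_neq0 N_gt0)) -sum_jump_prob.
  by apply: eq_bigr => z _; rewrite mulr1.
have PF z : P (F z) = (p * jump_prob b N h pi (y m) z)%:E.
  by rewrite prob_path_eventS PE.
rewrite (@ge0_integral_ae_partition _ _ _ P _ E F (neighbours h (y m)))//.
- have step z : (\int[P]_(t in F z)
        (\sum_(j < n.+1) gamma ^+ j * g (Y (m + j) t))%:E
      <= (p * jump_prob b N h pi (y m) z * (g (y m) + gamma * w z))%:E)%E.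
    (* On [F z] the term [j = 0] is the constant [g (y m)]; the others are [gamma] times the sum of
       [n] terms started at time [m.+1]. *)
    under eq_integral => t.
      rewrite inE => Ft.
      rewrite big_ord_recl expr0 mul1r addn0 (Ft m (leqnSn m)) /extend_path leqnn.
      under eq_bigr do rewrite lift0 exprS -mulrA addnS -addSn.
      rewrite -mulr_sumr EFinD EFinM.
      over.
    rewrite ge0_integralD//; last 3 first.
    + by move=> t _; rewrite lee_fin.
    + by move=> t _; rewrite mule_ge0// lee_fin// discounted_sum_ge0.
    + by apply: measurable_funeM; exact: measurable_discounted_sum.
    rewrite integral_cst// ge0_integralZl_EFin//; last 2 first.
    + by move=> t _; rewrite lee_fin discounted_sum_ge0.
    + exact: measurable_discounted_sum.
    have := IH m.+1 (extend_path m y z).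
    rewrite -/(F z) /extend_path ltnn PF => IHz.
    rewrite mulrDr EFinD [(_ * g _)%R]mulrC EFinM -PF leeD2l//.
    by rewrite mulrCA EFinM lee_wpmul2l// lee_fin.
  apply: le_trans (lee_sum _ (fun z _ => step z)) _.
  rewrite sumEFin PE -EFinM lee_fin.
  apply: le_trans (ler_wpM2l p_ge0 (w_super (y m))).
  rewrite -sum_jump_prob -[X in _ <= _ * (X + _)]mulr1 -sum1.
  rewrite !mulr_sumr -big_split mulr_sumr le_eqVlt; apply/orP; left; apply/eqP.
  by apply: eq_bigr => z _ /=; ring.
- exact: measurable_path_event.
- exact: undup_uniq.
- apply/trivIsetP => z1 z2 _ _ z12; rewrite /F !path_eventS -subset0 => t [[_ /= e1] [_ /= e2]].
  by move/eqP: z12; apply; rewrite -e1 -e2.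
- by move=> z; rewrite /F path_eventS => t [].
- under eq_bigr do rewrite PF.
  by rewrite sumEFin -mulr_sumr sum1 mulr1 PE.
- exact: measurable_discounted_sum.
- by move=> t _; rewrite lee_fin discounted_sum_ge0.
Qed.

Lemma expected_discounted_sum_le :
  (\int[P]_t \sum_(0 <= m <oo) (gamma ^+ m * g (Y m t))%:E <= (w x0)%:E)%E.
Proof.
have term_ge0 m t : (0 <= (gamma ^+ m * g (Y m t))%:E)%E.
  by rewrite lee_fin mulr_ge0// exprn_ge0.
have mterm m : measurable_fun setT (fun t => (gamma ^+ m * g (Y m t))%:E).
  exact: (@measurable_fun_chain m _ _ (fun y => (gamma ^+ m * g y)%:E)).
(* By monotone convergence it suffices to bound every partial sum. *)
rewrite integral_nneseries//; apply: lime_le.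
  by apply: is_cvg_nneseries => m _ _; exact: integral_ge0.
apply: nearW => n; rewrite big_mkord -ge0_integral_sum//.
under eq_integral do rewrite sumEFin.
have E0 : path_event 0 (fun=> x0) = [set t | Y 0%N t = x0].
  by apply/seteqP; split=> t Yt; [exact: Yt|case].
have PE0 : P (path_event 0 (fun=> x0)) = 1%E by have [_ _ <- _] := Y_chain; rewrite E0.
have mE0 := measurable_path_event 0 (fun=> x0).
(* The chain starts at [x0] only almost surely; off the null set where it does not, the path bound
   applies with [m = 0]. *)
rewrite (@ge0_negligible_integral _ _ _ P setT (~` path_event 0 (fun=> x0)))//.
- rewrite setTD setCK; apply: le_trans (path_discounted_sum_le n 0 (fun=> x0)) _.
  by rewrite PE0 mul1e.
- exact: measurableC.
- exact: (measurable_discounted_sum 0).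
- by move=> t _; rewrite lee_fin; exact: (discounted_sum_ge0 0).
- by rewrite [LHS](probability_setC P mE0) PE0 subee.
Qed.

End JumpChain.

(** * The scheme as a fixed-point equation, and its minimum principle *)

Section SchemeValue.
Context (R : realType) (d k : nat).
Context (b : 'rV[R]_d -> 'rV[R]_k -> 'rV[R]_d) (N h lambda : R).
Context (pi : 'rV[R]_d -> 'rV[R]_k).
Hypotheses (d_gt0 : (0 < d)%N) (N_gt0 : 0 < N) (h_gt0 : 0 < h) (lambda_gt0 : 0 < lambda).

Lemma jump_rate_gt0 : 0 < jump_rate d N h.
Proof. by rewrite /jump_rate divr_gt0// !mulr_gt0// ltr0n. Qed.

Lemma total_rate_gt0 : 0 < total_rate d lambda N h.
Proof. by rewrite addr_gt0// jump_rate_gt0. Qed.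

Lemma discount_ge0 : 0 <= discount d lambda N h.
Proof. by rewrite divr_ge0// ltW// (jump_rate_gt0, total_rate_gt0). Qed.

Lemma discount_lt1 : discount d lambda N h < 1.
Proof. by rewrite ltr_pdivrMr ?total_rate_gt0// mul1r ltrDr. Qed.

(** With viscosity [N * h], the value at [x ± h e_i] has coefficient [-(N ± b_i / 2) / h], which is
    minus [jump_rate] times the jump weight; the diagonal collects [2 * N / h] from each
    coordinate. *)
Lemma scheme_fixed_point (v : 'rV[R]_d -> R) x :
  lambda * v x - dot (b x (pi x)) (grad_h h v x) - (N * h) * laplace_h h v x =
  total_rate d lambda N h * v x - jump_rate d N h * jump_mean b N h pi v x.
Proof.
have d0 : d%:R != 0 :> R by rewrite pnatr_eq0 -lt0n.
rewrite /total_rate mulrDl -2!addrA; congr (_ + _).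
have -> : jump_rate d N h * v x = \sum_(i < d) (2 * N / h * v x).
  by rewrite sumr_const card_ord -[RHS]mulr_natr /jump_rate; field; rewrite gt_eqF.
rewrite /dot /laplace_h /jump_mean !mulr_sumr -!sumrN -!big_split.
apply: eq_bigr => i _ /=; rewrite mxE /jump_rate.
by field; rewrite d0 !gt_eqF.
Qed.

(** A minimum may not be attained, so the argument uses the infimum [m]: the mean is monotone and
    fixes constants, whence [gamma * m <= m], and [gamma < 1] forces [0 <= m]. *)
Lemma scheme_value_ge0 (v : 'rV[R]_d -> R) :
  (forall y i, `|b y (pi y) 0 i| / 2 <= N) ->
  (exists M, forall x, `|v x| <= M) ->
  (forall x, discount d lambda N h * jump_mean b N h pi v x <= v x) ->
  forall x, 0 <= v x.
Proof.
move=> wt [M vM] vsup x; pose m := inf (range v).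
have hi : has_inf (range v).
  split; first by exists (v x), x.
  by exists (- M) => _ [y _ <-]; have := vM y; rewrite ler_norml => /andP[].
have mv y : m <= v y by apply: (inf_lbound hi.2); exists y.
apply: le_trans (mv x).
have : discount d lambda N h * m <= m.
  apply: lb_le_inf hi.1 _ => _ [y _ <-]; apply: le_trans (vsup y).
  rewrite ler_wpM2l ?discount_ge0//.
  apply: le_trans (le_jump_mean h wt y mv).
  rewrite (_ : (fun=> m) = (fun=> m * 1)); last by apply/funext => z; rewrite mulr1.
  by rewrite jump_meanZ jump_mean1 ?gt_eqF// mulr1.
by have := discount_lt1; nra.
Qed.

End SchemeValue.

(** * Bounds on distance and drift, and the occupation estimate *)

Lemma dist_ge0 (R : realType) (d : nat) (x : 'rV[R]_d) (D : set 'rV[R]_d) : 0 <= dist x D.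
Proof.
(* The infimum of the empty set is 0 by convention. *)
rewrite /dist; have [->|D0] := eqVneq D set0; first by rewrite image_set0 inf0.
apply: lb_le_inf; first by apply/image_nonempty/set0P.
by move=> _ [z _ <-]; exact: sqrtr_ge0.
Qed.

Lemma coord_le_enorm (R : realType) (d : nat) (u : 'rV[R]_d) i : `|u 0 i| <= enorm u.
Proof.
rewrite -sqrtr_sqr ler_sqrt ?sqr_ge0//; last by apply: sumr_ge0 => j _; exact: sqr_ge0.
by rewrite (bigD1 i)//= lerDl sumr_ge0// => j _; exact: sqr_ge0.
Qed.

(** Boundedness of [b] makes [sup_coord] a genuine supremum rather than a default value. *)
Lemma coord_le_sup_coord (R : realType) (d k : nat) (A : set 'rV[R]_k)
  (b : 'rV[R]_d -> 'rV[R]_k -> 'rV[R]_d) x a i :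
  (exists M, forall x a, A a -> enorm (b x a) <= M) -> A a ->
  `|b x a 0 i| <= sup_coord A b.
Proof.
move=> [M bM] Aa; apply: (@le_trans _ _ (max_coord (b x a))).
  exact: le_bigmax.
apply: ub_le_sup; last by exists x, a.
exists M => _ [y [c [Ac ->]]]; apply/bigmax_leP; split.
  by apply: le_trans (bM y c Ac); exact: sqrtr_ge0.
by move=> j _; apply: le_trans (bM y c Ac); exact: coord_le_enorm.
Qed.

Theorem lemma5p1 (R : realType) (d k : nat) (d_gt0 : (0 < d)%N)
  (Omega : set 'rV[R]_d) (n : 'rV[R]_d -> 'rV[R]_d)
  (Omega_open : open Omega) (Omega_connected : connected Omega)
  (Omega_nonempty : Omega !=set0) (Omega_bounded : bounded_set Omega)
  (Omega_C2 : C2_boundary Omega)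
  (n_normal : forall z, bdry Omega z -> outward_unit_normal Omega z (n z))
  (A : set 'rV[R]_k) (A_compact : compact A)
  (lambda : R) (lambda_gt0 : 0 < lambda)
  (b : 'rV[R]_d -> 'rV[R]_k -> 'rV[R]_d) (f : 'rV[R]_d -> 'rV[R]_k -> R)
  (f_ge0 : forall x a, A a -> 0 <= f x a)
  (b_cont : {within [set: 'rV[R]_d] `*` A, continuous (fun q => b q.1 q.2)})
  (f_cont : {within [set: 'rV[R]_d] `*` A, continuous (fun q => f q.1 q.2)})
  (b_bounded : exists M : R, forall x a, A a -> enorm (b x a) <= M)
  (f_bounded : exists M : R, forall x a, A a -> f x a <= M)
  (b_Lip : (Lip_x A b < lambda%:E)%E)
  (f_Lip : exists L : R, forall x y a, A a ->
     `|f x a - f y a| <= L * enorm (x - y))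
  (inward : exists2 nu : R, 0 < nu &
     forall x, bdry Omega x -> exists2 a, A a & dot (b x a) (n x) <= - nu)
  (H_coercive : uniformly_coercive_on A b f (closure Omega))
  (Mp : R) (Mp_gt0 : 0 < Mp)
  (N : R) (N_gt0 : 0 < N) (N_ge : 2^-1 * sup_coord A b <= N)
  (h eps : R) (h_gt0 : 0 < h) (eps_gt0 : 0 < eps)
  (pi : 'rV[R]_d -> 'rV[R]_k) (pi_A : forall x, A (pi x))
  (pi_borel : borel_map pi)
  (S_pi : 'rV[R]_d -> R)
  (S_value : is_scheme_value Omega b f lambda Mp N h eps pi S_pi)
  (x0 : 'rV[R]_d) (C0 : R) (S_le : S_pi x0 <= C0)
  (disp : measure_display) (T : measurableType disp) (P : probability T R)
  (Y : nat -> T -> 'rV[R]_d) (Y_chain : is_jump_chain b N h pi x0 P Y)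
  (delta : R) (delta_gt0 : 0 < delta) (delta_le : delta <= Mp) :
  ((total_rate d lambda N h)^-1%:E *
     \int[P]_t \sum_(0 <= m <oo)
       (discount d lambda N h ^+ m *
        \1_[set y | delta <= dist y (closure Omega)] (Y m t))%:E
   <= (C0 * eps / delta)%:E)%E.

Proof.
have [_ S_bounded S_eq] := S_value.
have wt y i : `|b y (pi y) 0 i| / 2 <= N.
  apply: le_trans N_ge; rewrite mulrC ler_pM2l ?invr_gt0//.
  exact: coord_le_sup_coord.
set mu := total_rate d lambda N h; set gamma := discount d lambda N h.
have mu_gt0 : 0 < mu by exact: total_rate_gt0.
pose c := running_cost Omega f Mp eps pi.
have fixed x : S_pi x = gamma * jump_mean b N h pi S_pi x + c x / mu.
  have := S_eq x; rewrite (scheme_fixed_point b lambda pi d_gt0 N_gt0 h_gt0 S_pi x) -/mu -/(c x) => <-.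
  by rewrite /gamma /discount -/mu; field; rewrite gt_eqF.
have pen_ge0 x : 0 <= penalty Omega Mp x by rewrite le_min dist_ge0 ltW.
have c_ge x : penalty Omega Mp x / eps <= c x by rewrite lerDr f_ge0.
have c_ge0 x : 0 <= c x by apply: le_trans (c_ge x); rewrite divr_ge0// ltW.
have S_ge0 : forall x, 0 <= S_pi x.
  apply: (scheme_value_ge0 d_gt0 N_gt0 h_gt0 lambda_gt0 wt S_bounded) => x.
  by rewrite -/gamma [leRHS]fixed lerDl divr_ge0// ltW.
have K_ge0 : 0 <= mu * eps / delta by rewrite divr_ge0 ?mulr_ge0// ltW.
(* The factor turns the source [c / mu] into [eps * c / delta], which is at least 1 where the
   indicator is 1. *)
pose w y := mu * eps / delta * S_pi y.
pose g y : R := \1_[set y | delta <= dist y (closure Omega)] y.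
have w_super y : g y + gamma * jump_mean b N h pi w y <= w y.
  rewrite jump_meanZ /w [in leRHS]fixed mulrDr mulrCA addrC lerD2l.
  rewrite (_ : _ * (c y / mu) = eps * c y / delta); last by field; rewrite !gt_eqF.
  (* Where the indicator vanishes, [0 <= c y] is enough. *)
  rewrite ler_pdivlMr// /g indicE; case: (boolP (_ \in _)) => [/set_mem /= dy|_]; last first.
    by rewrite mul0r mulr_ge0// ltW.
  (* Here [delta <= Mp] enters: truncating the distance at [Mp] leaves the penalty at least
     [delta]. *)
  rewrite mul1r; apply: (@le_trans _ _ (penalty Omega Mp y)); first by rewrite le_min dy.
  by rewrite -ler_pdivrMl// mulrC.
have g_ge0 y : 0 <= g y by rewrite /g indicE.
have w_ge0 y : 0 <= w y by rewrite mulr_ge0.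
have gamma_ge0 : 0 <= gamma by exact: discount_ge0.
have := expected_discounted_sum_le Y_chain d_gt0 N_gt0 gamma_ge0 g_ge0 w_ge0
  w_super.
(* Multiplying by the inverse of [mu] cancels the [mu] in [w x0] and leaves
   [S_pi x0 * (eps / delta)]. *)
rewrite -(@lee_pmul2l _ mu^-1%:E)//; last by rewrite lte_fin invr_gt0.
move=> /le_trans; apply; rewrite -EFinM lee_fin.
rewrite (_ : _ * w x0 = S_pi x0 * (eps / delta)); last by rewrite /w; field; rewrite !gt_eqF.
by rewrite -[leRHS]mulrA ler_wpM2r// divr_ge0// ltW.
Qed.
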